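(* If $G$ is a 3-connected almost wheel-free graph, then $G$ is minimally 3-connected.
   Context: Graphs are finite, simple and undirected. A wheel $(C,v)$ in a graph $G$ consists of a cycle $C$ of $G$ (as a subgraph, not necessarily induced; called the rim) and a vertex $v\in V(G)\setminus V(C)$ (the center) having at least three neighbors in $V(C)$. $W(G)$ denotes the set of all vertices $u$ of $G$ such that at least one wheel of $G$ is centered at $u$. A graph $G$ is almost wheel-free if $W(G)$ is either empty, or made of a single vertex of degree 3 in $G$, or made of two adjacent vertices, both of degree 3 in $G$ (in particular every wheel-free graph, i.e. graph with $W(G)=\emptyset$, is almost wheel-free). $\kappa(G)$ denotes the (vertex-)connectivity of $G$. An edge $e$ of $G$ is essential if $\kappa(G\setminus e)<\kappa(G)$, where $G\setminus e$ is $G$ with the edge $e$ deleted (its ends are kept). A graph is minimally $k$-connected if it has connectivity exactly $k$ and all its edges are essential. *)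

(* Defs.v *)
From mathcomp Require Import all_boot.

Set Implicit Arguments.
Unset Strict Implicit.
Unset Printing Implicit Defensive.

Record sgraph := SGraph {
  vertex :> finType;
  adj : rel vertex;
  adj_sym : symmetric adj;
  adj_irrefl : irreflexive adj
}.

Section GraphNotions.
Variable G : sgraph.
Implicit Types (u v x y : G) (S : {set G}) (c : seq G) (k : nat).

Definition neighbours v : {set G} := [set u | adj v u].

Definition deg v : nat := #|neighbours v|.

(* [ucycleb] asks for pairwise distinct vertices, consecutive ones (cyclically)
   being adjacent; chords are allowed. Lengths 1 and 2 must be excluded. *)
Definition is_cycle c : bool := (2 < size c) && ucycleb (@adj G) c.

Definition is_wheel c v : bool :=
  [&& is_cycle c, v \notin c & 2 < #|[set u in c | u \in neighbours v]|].

(* The length bound loses nothing, since a cycle has at most #|G| vertices: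
   see [wheel_centersP]. *)
Definition wheel_centers : {set G} :=
  [set u | [exists n : 'I_#|G|.+1, [exists c : n.-tuple G, is_wheel c u]]].

Lemma wheel_centersP u :
  reflect (exists c, is_wheel c u) (u \in wheel_centers).
Proof.
rewrite inE; apply: (iffP existsP) => [[n /existsP[c Hc]]|[c Hc]].
  by exists c.
have Uc : uniq c by case/and3P: Hc => /andP[_ /andP[_ ->]].
have lt_c : size c < #|G|.+1 by rewrite ltnS -(card_uniqP Uc) max_card.
by exists (Ordinal lt_c); apply/existsP; exists (in_tuple c).
Qed.

Definition almost_wheel_free : Prop :=
  [\/ wheel_centers = set0,
      exists2 u, wheel_centers = [set u] & deg u = 3
    | exists u v, [/\ wheel_centers = [set u; v], adj u v, deg u = 3
                    & deg v = 3]].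

Definition connected_without S : bool :=
  [forall x in ~: S, forall y in ~: S,
     connect [rel a b | [&& a \notin S, b \notin S & adj a b]] x y].

(* The bound on the number of vertices gives the complete graph on n vertices
   connectivity n - 1. *)
Definition kconnected k : bool :=
  (k < #|G|) && [forall S : {set G}, (#|S| < k) ==> connected_without S].

Definition kappa : nat := \max_(k < #|G| | kconnected k) k.

Lemma leq_kappa k : 0 < #|G| -> (k <= kappa) = kconnected k.
Proof.
move=> G_gt0; have K0 : kconnected 0.
  by rewrite /kconnected G_gt0; apply/forallP.
apply/idP/idP => [le_k|Kk]; last first.
  have ltk : k < #|G| by case/andP: Kk.
  exact: (@leq_bigmax_cond _ (fun i : 'I_#|G| => kconnected i) val
            (Ordinal ltk)).
have [i Ki def_i] : {i : 'I_#|G| | kconnected i & kappa = i}.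
  apply: (@eq_bigmax_cond _ (fun i : 'I_#|G| => kconnected i) val).
  by apply/card_gt0P; exists (Ordinal G_gt0).
rewrite def_i in le_k; case/andP: Ki => lti /forallP Ki.
apply/andP; split; first exact: leq_ltn_trans lti.
apply/forallP => S; apply/implyP => ltS.
exact: (implyP (Ki S)) (leq_trans ltS le_k).
Qed.

End GraphNotions.

Section DeleteEdge.
Variables (G : sgraph) (x y : G).

Definition del_adj : rel G :=
  [rel a b | adj a b && ([set a; b] != [set x; y])].

Lemma del_adj_sym : symmetric del_adj.
Proof. by move=> a b; rewrite /del_adj /= adj_sym setUC. Qed.

Lemma del_adj_irrefl : irreflexive del_adj.
Proof. by move=> a; rewrite /del_adj /= adj_irrefl. Qed.

Definition delete_edge : sgraph := SGraph del_adj_sym del_adj_irrefl.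

Definition essential : bool := kappa delete_edge < kappa G.

End DeleteEdge.

Definition minimally_kconnected (G : sgraph) (k : nat) : Prop :=
  kappa G = k /\ forall x y : G, adj x y -> essential x y.

(* Main.v *)
Require Import Defs.
From mathcomp Require Import all_boot zify.

(** Suppose that deleting the edge [xy] leaves a 3-connected graph G' (this is so
if [xy] is not essential, and for every edge if [G] is 4-connected). Then [x] has
degree at least 4, and the point is that [x] is the center of a wheel, so that
[G] is not almost wheel-free. Put H = G' - x, which is 2-connected, and let N be the set of
neighbours of [x] in G'; every two vertices of H other than [y] fail to separate
[y] from N in H. We need a cycle of H through [y] and two vertices of N. Closing
ears by 2-connectivity yields such a cycle or a theta subgraph whose three paths
between branch vertices [a] and [b] contain [y], [n1] and [n2] respectively, with
[n1], [n2] in N. Take one with the path through [y] as short as possible: some ear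
leaves the interior of that path, avoids [a] and [b], and either lands inside
another path or goes through a new vertex of N. Each of its possible landing
points gives the cycle or a theta whose path through [y] is shorter. *)

Set Implicit Arguments.
Unset Strict Implicit.
Unset Printing Implicit Defensive.

(** * Walks described by their interiors *)

Section Walks.
Variables (T : finType) (h : rel T).
Hypothesis h_sym : symmetric h.
Implicit Types (w p q y : T) (s : seq T).

(* [s] lists the interior vertices only. *)
Definition walk u s v : bool := path h u (rcons s v).

Lemma walk_cat u s w t v :
  walk u (s ++ w :: t) v = walk u s w && walk w t v.
Proof.
by rewrite /walk rcons_cat rcons_cons -cat_rcons cat_path last_rcons.
Qed.

Lemma walk_nil u v : walk u [::] v = h u v.
Proof. by rewrite /walk /= andbT. Qed.

Lemma walk_cons u w t v : walk u (w :: t) v = h u w && walk w t v.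
Proof. by []. Qed.

Lemma walk_rev u s v : walk u (rev s) v = walk v s u.
Proof.
rewrite /walk -rev_cons -{1}(last_rcons v s u) -(belast_rcons v s u) rev_path.
by apply: eq_path => a b; rewrite h_sym.
Qed.

Lemma uniq_count (U : eqType) (s : seq U) :
  reflect (forall z, count_mem z s <= 1) (uniq s).
Proof.
apply: (iffP idP) => [Us z|le1]; first by rewrite (count_uniq_mem z Us) leq_b1.
elim: s le1 => //= a s IHs le1; apply/andP; split.
  by have := le1 a; rewrite eqxx -has_pred1 has_count -leqNgt add1n ltnS.
by apply: IHs => z; have := le1 z; lia.
Qed.

Lemma cat_uniq_disjoint (U : eqType) (s t : seq U) :
  (forall z, z \in s -> z \notin t) -> uniq s -> uniq t -> uniq (s ++ t).
Proof.
move=> dis Us Ut; rewrite cat_uniq Us Ut andbT /=.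
by apply/hasPn => z zt; apply/negP => zs; move: (dis z zs); rewrite zt.
Qed.

Definition avoiding (A : pred T) : rel T :=
  [rel a b | [&& ~~ A a, ~~ A b & h a b]].

(** A shortest walk from [X] to [Y] meets these sets only at its ends: an inner vertex of [X] could
    serve as the start, one of [Y] as the end. Disjointness of [X] and [Y] rules out a walk reduced
    to a single vertex. *)
Lemma connect_walk (A X Y : pred T) u v :
    (forall z, X z -> ~~ Y z) ->
    X u -> Y v -> connect (avoiding A) u v ->
  exists p q s, [/\ X p, Y q, walk p s q, uniq s
    & forall z, z \in s -> [/\ ~~ X z, ~~ Y z & ~~ A z]].
Proof.
move=> disXY Xu + /connectP[l l_path l_last]; rewrite {v}l_last.
have [m] := ubnP (size l); elim: m u l Xu l_path => // m IHm u l0 Xu.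
case/shortenP=> l l_path Ul sub_l size_l0.
have {l0 sub_l size_l0} size_l : size l < m.+1.
  by apply: leq_ltn_trans size_l0; apply: uniq_leq_size => //; case/andP: Ul.
case/lastP: l l_path Ul size_l => [|s q] l_path Ul size_l.
  by rewrite (negPf (disXY u Xu)).
rewrite last_rcons => Yq; rewrite size_rcons ltnS in size_l.
case: (boolP (has X s)) => [/hasP[z zs Xz]|/hasPn nXs].
  case/splitPr: zs l_path size_l {Ul} => s1 s2.
  rewrite rcons_cat cat_path size_cat /= => /and3P[_ _ s2_path] size_l.
  apply: (IHm z (rcons s2 q)); rewrite ?last_rcons ?size_rcons //; lia.
case: (boolP (has Y s)) => [/hasP[z zs Yz]|/hasPn nYs].
  case/splitPr: zs l_path size_l {Ul nXs} => s1 s2.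
  rewrite rcons_cat rcons_cons -cat_rcons cat_path size_cat /=.
  case/andP=> s1_path _ size_l.
  apply: (IHm u (rcons s1 z)); rewrite ?last_rcons ?size_rcons //; lia.
exists u, q, s; split=> //.
- by apply: sub_path l_path => a b /and3P[].
- by move: Ul; rewrite cons_uniq rcons_uniq => /and3P[].
- move=> z zs; split; [exact: nXs | exact: nYs|].
  have: all [pred z | ~~ A z] (rcons s q).
    elim: (rcons s q) u l_path {Ul Xu} => //= a l IHl u /andP[/and3P[_ -> _]].
    exact: IHl.
  by move/allP/(_ z); apply; rewrite mem_rcons inE zs orbT.
Qed.

Lemma count_cons (U : Type) (a : pred U) z (s : seq U) :
  count a (z :: s) = a z + count a s.
Proof. by []. Qed.

Ltac count_lia :=
  let z := fresh in
  intro z; rewrite ?(count_cat, count_rev, count_cons) /=;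
  repeat match goal with
         | |- context [count ?a ?s] => generalize (count a s)
         | |- context [nat_of_bool ?b] => generalize (nat_of_bool b)
         end; clear; lia.

(** * Ears through a prescribed vertex *)

Section Ears.
Variable V : pred T.
Hypothesis h_V : forall a b, h a b -> V b.
Hypothesis h_2conn : forall v a b, V a -> V b -> a != v -> b != v ->
  connect (avoiding (pred1 v)) a b.
Variable th : seq T.

(* [p] is meant to lie on [th]; the ear is the path [p], [s1], [w], [s2], [t]. *)
Definition ear p w : Prop := exists t s1 s2,
  [/\ t \in th, t != p, walk p s1 w, walk w s2 t
    & uniq (s1 ++ w :: s2) /\ forall z, z \in s1 ++ w :: s2 -> z \notin th].

(** After removal of [p], 2-connectivity leads from [w] to [o]; the first vertex of [th] on that
    path ends an ear whose part before [w] is the single edge [pw]. *)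
Lemma ear_start p o w :
  p \in th -> o \in th -> o != p -> V o -> h p w -> w \notin th -> ear p w.
Proof.
move=> p_th o_th op Vo hpw w_th.
have wp : w != p by apply: contraNneq w_th => ->.
have := h_2conn (h_V hpw) Vo wp op.
case/(@connect_walk _ (pred1 w) [pred z | (z \in th) && (z != p)]).
- by move=> z /eqP->; rewrite /= (negPf w_th).
- exact: eqxx.
- by rewrite /= o_th.
move=> _ [t [s [/eqP-> /andP[t_th tp] s_walk Us avs]]].
exists t, [::], s; rewrite walk_nil; split=> //=; split=> [|z].
  by rewrite Us andbT; apply/negP => /avs[]; rewrite /= eqxx.
rewrite inE => /predU1P[->//|/avs[_ /=]].
by case: (z \in th) => //= /negPf->.
Qed.

(* If [w] is off the ear through [u], a path from [w] to the ear or to [th] that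
   avoids [u] lets the ear be rerouted along the edge [uw]. *)
Lemma ear_step p o u w :
    p \in th -> o \in th -> o != p -> V o -> ear p u -> h u w -> w \notin th ->
  ear p w.
Proof.
move=> p_th o_th op Vo [t [s1 [s2 [t_th tp walk1 walk2 [U av]]]]] huw w_th.
have [w_s|w_s] := boolP (w \in s1 ++ u :: s2).
  have : [|| w \in s1, w == u | w \in s2] by rewrite mem_cat inE in w_s.
  case/or3P=> [/splitPr eq_s|/eqP->|/splitPr eq_s].
  - case: eq_s walk1 U av {w_s} => s11 s12; rewrite walk_cat => /andP[? ?] U av.
    exists t, s11, (s12 ++ u :: s2); rewrite walk_cat; split=> //.
      by apply/andP.
    by move: U av; rewrite -catA.
  - by exists t, s1, s2.
  - case: eq_s walk2 U av {w_s} => s21 s22; rewrite walk_cat => /andP[? ?] U av.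
    exists t, (s1 ++ u :: s21), s22; rewrite walk_cat; split=> //.
      by apply/andP.
    by move: U av; rewrite -catA.
have u_th : u \notin th by apply: av; rewrite mem_cat inE eqxx orbT.
have ou : o != u by apply: contraNneq u_th => <-.
have wu : w != u by apply: contraNneq w_s => ->; rewrite mem_cat inE eqxx orbT.
have := h_2conn (h_V huw) Vo wu ou.
case/(@connect_walk _ (pred1 w) (mem (s1 ++ s2 ++ th))).
- move=> z /eqP->; move: w_s; rewrite /= !mem_cat inE !negb_or.
  by case/and3P=> -> _ ->.
- exact: eqxx.
- by rewrite /= !mem_cat o_th !orbT.
move=> _ [q [e [/eqP-> /= q_s e_walk Ue ave]]].
have {ave} e_out z : z \in e -> z \notin w :: u :: s1 ++ s2 ++ th.
  by move/ave=> /= [+ + +]; rewrite !inE !negb_or => -> -> ->.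
have Ucnt : forall z, count_mem z (e ++ w :: s1 ++ u :: s2) <= 1.
  apply/uniq_count/cat_uniq_disjoint => //.
    move=> z /e_out; rewrite !(inE, mem_cat).
    by rewrite !negb_or => /and5P[-> -> -> -> _].
  by rewrite cons_uniq w_s.
have av' z : z \in e ++ w :: s1 ++ u :: s2 -> z \notin th.
  rewrite mem_cat inE => /or3P[/e_out|/eqP->//|/av//].
  by rewrite !(inE, mem_cat) !negb_or => /and5P[].
have finish t' s1' s2' : t' \in th -> t' != p ->
    walk p s1' w -> walk w s2' t' ->
    (forall z, count_mem z (s1' ++ w :: s2') <=
       count_mem z (e ++ w :: s1 ++ u :: s2)) -> ear p w.
  move=> *; exists t', s1', s2'; split=> //; split.
    by apply/uniq_count => z; apply: leq_trans (Ucnt z).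
  move=> z; rewrite -has_pred1 has_count => z_gt0; apply: av'.
  by rewrite -has_pred1 has_count; apply: leq_trans z_gt0 _.
(* The path [e] from [w] first meets the old ear or [th] at [q]. If [q] precedes [u], the new ear
   turns off at [q], runs back along [e] to [w] and rejoins the old one at [u]; if [q] follows [u],
   it goes from [u] over [w] and [e] to [q]. *)
move: q_s; rewrite !mem_cat => /or3P[/splitPr eq_s|/splitPr eq_s|q_th].
- case: eq_s walk1 finish {U av Ucnt av' w_s e_out} => s11 s12.
  rewrite walk_cat => /andP[? ?] finish.
  apply: (finish t (s11 ++ q :: rev e) (u :: s2)) => //.
  + by rewrite walk_cat walk_rev; apply/andP.
  + by rewrite walk_cons h_sym huw.
  + by count_lia.
- case: eq_s walk2 finish {U av Ucnt av' w_s e_out} => s21 s22.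
  rewrite walk_cat => /andP[? ?] finish.
  apply: (finish t (s1 ++ [:: u]) (e ++ q :: s22)) => //.
  + by rewrite walk_cat walk_nil; apply/andP.
  + by rewrite walk_cat; apply/andP.
  + by count_lia.
(* An ear may not end where it starts, so for [q = p] the reverse of [e] becomes its first part. *)
have [eq_qp|qp] := eqVneq q p.
  apply: (finish t (rev e) (u :: s2)) => //.
  + by rewrite walk_rev -eq_qp.
  + by rewrite walk_cons h_sym huw.
  + by count_lia.
apply: (finish q (s1 ++ [:: u]) e) => //.
+ by rewrite walk_cat walk_nil; apply/andP.
+ by count_lia.
Qed.

(** Induction along the walk: [ear_start] gives an ear through its first vertex after [p], and
    [ear_step] carries the ear from each vertex to the next. *)
Lemma ear_through p o s w :
    p \in th -> o \in th -> o != p -> V o -> walk p s w ->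
    (forall z, z \in s -> z \notin th) -> w \notin th ->
  ear p w.
Proof.
move=> p_th o_th op Vo; elim/last_ind: s w => [|s u IHs] w.
  by rewrite walk_nil => hpw _; apply: (ear_start p_th o_th).
rewrite -cats1 walk_cat walk_nil => /andP[s_walk huw] av.
apply: (ear_step p_th o_th op Vo (u := u)) => //.
apply: IHs => // [z zs|]; apply: av.
  by rewrite mem_cat zs.
by rewrite mem_cat inE eqxx orbT.
Qed.

End Ears.

(** * Cycles through [y] and two vertices of [N] *)

Section RichCycle.
Variables (V N : pred T) (y : T).

(** [y], [n] and [n'] are to be three neighbours of the center on the rim; being distinct, they also
    force the length to be at least 3. *)
Definition rich_cycle : Prop := exists s n n',
  [/\ walk y s y, uniq (y :: s), n \in s /\ n' \in s, N n /\ N n' & n != n'].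

(** A cycle may be listed from any of its vertices, so it can be rotated to start at [y].
    Distinctness is put as a bound on multiplicities to suit cycles pieced together from parts of a
    theta. *)
Lemma rich_cycleI u s n n' : walk u s u ->
    (forall z, count_mem z (u :: s) <= 1) ->
    (forall z, count_mem z [:: y; n; n'] <= 1) ->
    y \in u :: s -> n \in u :: s -> n' \in u :: s -> N n -> N n' ->
  rich_cycle.
Proof.
move=> s_walk /uniq_count Us /uniq_count + y_s n_s n'_s Nn Nn'.
rewrite /= !inE negb_or andbT => /andP[/andP[yn yn'] nn'].
have [s' [s'_walk Us' sub]] : exists s', [/\ walk y s' y, uniq (y :: s') &
    u :: s =i y :: s'].
  have [eq_yu|yu] := eqVneq y u; first by exists s; rewrite eq_yu.
  have y_in : y \in s by move: y_s; rewrite inE (negPf yu).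
  case/splitPr: y_in s_walk Us {y_s n_s n'_s} => s1 s2.
  rewrite walk_cat => /andP[walk1 walk2] Us.
  exists (s2 ++ u :: s1); rewrite walk_cat walk1 walk2; split=> //.
    rewrite -(perm_uniq (s1 := u :: s1 ++ y :: s2)) // -cat_cons.
    by rewrite -[y :: s2 ++ _]cat_cons perm_catC.
  by apply: perm_mem; rewrite -[y :: s2 ++ _]cat_cons -cat_cons perm_catC.
exists s', n, n'; move: n_s n'_s; rewrite !sub !inE.
by rewrite ![_ == y]eq_sym (negPf yn) (negPf yn').
Qed.

Ltac split_walks :=
  repeat match goal with H : is_true (_ && _) |- _ => case/andP: H => ? ? end.
Ltac walks :=
  rewrite ?(walk_cat, walk_rev); repeat (apply/andP; split); assumption.
Ltac members := rewrite ?(mem_cat, inE, mem_rev) ?eqxx ?orbT //.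

(* [a] and [b] are the branch vertices; the paths between them have interiors
   [s1 ++ y :: s2], [u1 ++ n1 :: u2] and [v1 ++ n2 :: v2]. *)
Definition theta a b s1 s2 u1 n1 u2 v1 n2 v2 : Prop :=
  [/\ [/\ walk a s1 y & walk y s2 b], walk a u1 n1 && walk n1 u2 b,
      walk a v1 n2 && walk n2 v2 b,
      forall z, count_mem z
        ((a :: b :: s1 ++ y :: s2) ++ (u1 ++ n1 :: u2) ++ v1 ++ n2 :: v2) <= 1
    & N n1 && N n2].

Definition shorter_theta m : Prop :=
  exists a b s1 s2 u1 n1 u2 v1 n2 v2,
    theta a b s1 s2 u1 n1 u2 v1 n2 v2 /\ size s1 + size s2 < m.

(* Uniqueness of a list built from pieces of [U]'s list is linear arithmetic on
   the multiplicities of a vertex in the pieces. *)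
Ltac use U :=
  let z := fresh in
  intro z; move: (U z); rewrite ?(count_cat, count_rev, count_cons) /=;
  repeat match goal with
         | |- context [count ?a ?s] => generalize (count a s)
         | |- context [nat_of_bool ?b] => generalize (nat_of_bool b)
         end; clear; lia.

(** * Symmetries of a theta *)

Section Theta.
Variables (a b : T) (s1 s2 u1 : seq T) (n1 : T) (u2 v1 : seq T) (n2 : T).
Variable v2 : seq T.
Hypothesis th_theta : theta a b s1 s2 u1 n1 u2 v1 n2 v2.

(** Together with [theta_swap], this reduces a starting point on the path through [y] to [y] itself
    or a vertex of [s1], and a landing point on the two other paths to one on the path through
    [n1]. *)
Lemma theta_rev :
  theta b a (rev s2) (rev s1) (rev u2) n1 (rev u1) (rev v2) n2 (rev v1).
Proof.
case: th_theta => [[w1 w2] w3 w4 U Nn]; split_walks.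
split; try walks; [by split; walks | by use U].
Qed.

Lemma theta_swap : theta a b s1 s2 v1 n2 v2 u1 n1 u2.
Proof.
case: th_theta => [[w1 w2] w3 w4 U /andP[N1 N2]].
split=> //; [by use U | by apply/andP].
Qed.

End Theta.

(** * Chords and ears attached to a theta *)

Section Chords.
Variables (a b : T) (s1 s2 u1 : seq T) (n1 : T) (u2 v1 : seq T) (n2 : T).
Variable v2 : seq T.
Let th := (a :: b :: s1 ++ y :: s2) ++ (u1 ++ n1 :: u2) ++ v1 ++ n2 :: v2.
Hypothesis th_theta : theta a b s1 s2 u1 n1 u2 v1 n2 v2.

(** From [t], the cycle continues in the direction of [n1] up to a branch vertex, follows the whole
    path through [n2], and returns to [y] from the other branch vertex. *)
Lemma chord_from_y e t :
    walk y e t -> (forall z, count_mem z (th ++ e) <= 1) ->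
    t \in u1 ++ n1 :: u2 -> rich_cycle.
Proof.
rewrite {}/th; case: th_theta => [[w1 w2] w3 w4 _ Nn] e_walk U.
rewrite mem_cat inE => /or3P[/splitPr eq_u|/eqP eq_t|/splitPr eq_u].
- case: eq_u w3 U => u11 u12; rewrite walk_cat => w3 U; split_walks.
  apply: (@rich_cycleI y (e ++ t :: u12 ++ n1 :: u2 ++ b :: rev v2 ++ n2 ::
    rev v1 ++ a :: s1) n1 n2) => //; [walks | use U | use U | | |]; members.
- subst t; split_walks.
  apply: (@rich_cycleI y (e ++ n1 :: u2 ++ b :: rev v2 ++ n2 ::
    rev v1 ++ a :: s1) n1 n2) => //; [walks | use U | use U | | |]; members.
- case: eq_u w3 U => u21 u22; rewrite !walk_cat => w3 U; split_walks.
  apply: (@rich_cycleI y (e ++ t :: rev u21 ++ n1 :: rev u1 ++ a :: v1 ++ n2 ::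
    v2 ++ b :: rev s2) n1 n2) => //; [walks | use U | use U | | |]; members.
Qed.

(** If [t] lies strictly between [a] and [n1], then [p] replaces [a] as a branch vertex and the path
    through [y] loses its part before [p]. Otherwise a cycle runs from [t] back through [n1] to [a],
    then through [n2] to [b], then through [y] to [p]. *)
Lemma chord_across p e t :
    walk p e t -> (forall z, count_mem z (th ++ e) <= 1) ->
    p \in s1 -> t \in u1 ++ n1 :: u2 ->
  rich_cycle \/ shorter_theta (size s1 + size s2).
Proof.
rewrite {}/th; case: th_theta => [[w1 w2] w3 w4 _ Nn] e_walk U p_s1.
case/splitPr: p_s1 w1 U => s11 s12; rewrite walk_cat => w1 U.
rewrite mem_cat inE => /or3P[/splitPr eq_u|/eqP eq_t|/splitPr eq_u].
- case: eq_u w3 U => u11 u12; rewrite walk_cat => w3 U; split_walks; right.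
  exists p, b, s12, s2, (e ++ t :: u12), n1, u2, (rev s11 ++ a :: v1), n2, v2.
  split; last by rewrite size_cat /=; clear; lia.
  by split; [split; walks | walks | walks | use U | walks].
- subst t; split_walks; left.
  apply: (@rich_cycleI p (e ++ n1 :: rev u1 ++ a :: v1 ++ n2 :: v2 ++ b ::
    rev s2 ++ y :: rev s12) n1 n2) => //;
    [walks | use U | use U | | |]; members.
- case: eq_u w3 U => u21 u22; rewrite !walk_cat => w3 U; split_walks; left.
  apply: (@rich_cycleI p (e ++ t :: rev u21 ++ n1 :: rev u1 ++ a :: v1 ++ n2 ::
    v2 ++ b :: rev s2 ++ y :: rev s12) n1 n2) => //;
    [walks | use U | use U | | |]; members.
Qed.

(** The ear supplies [n]; from [t] the cycle goes on to [a] and returns by the path through [n1] and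
    by [s2]. *)
Lemma ear_from_y e1 n e2 t :
    walk y e1 n -> walk n e2 t -> N n ->
    (forall z, count_mem z (th ++ e1 ++ n :: e2) <= 1) ->
    t \in a :: s1 -> rich_cycle.
Proof.
rewrite {}/th; case: th_theta => [[w1 w2] w3 w4 _ Nn] e1_walk e2_walk N_n U.
rewrite inE => /predU1P[eq_t|/splitPr eq_s].
  subst t; split_walks.
  apply: (@rich_cycleI y (e1 ++ n :: e2 ++ a :: u1 ++ n1 :: u2 ++ b :: rev s2)
    n n1) => //; [walks | use U | use U | | |]; members.
case: eq_s w1 U => s11 s12; rewrite walk_cat => w1 U; split_walks.
apply: (@rich_cycleI y (e1 ++ n :: e2 ++ t :: rev s11 ++ a :: u1 ++ n1 :: u2
  ++ b :: rev s2) n n1) => //; [walks | use U | use U | | |]; members.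
Qed.

(** An ear that jumps over [y], landing at [b] or in [s2], is itself a path of a new theta with
    branch vertices [p] and [t], where the path through [n2] is dropped. Any other ear replaces a
    piece of the cycle through [y] and [n1] that does not have [y] inside. *)
Lemma ear_across p e1 n e2 t :
    walk p e1 n -> walk n e2 t -> N n ->
    (forall z, count_mem z (th ++ e1 ++ n :: e2) <= 1) ->
    p \in s1 -> t \in a :: b :: s1 ++ y :: s2 -> t != p ->
  rich_cycle \/ shorter_theta (size s1 + size s2).
Proof.
rewrite {}/th; case: th_theta => [[w1 w2] w3 w4 _ Nn] e1_walk e2_walk N_n U p_s.
case/splitPr: p_s w1 U => s11 s12; rewrite walk_cat => w1 U.
have Nn1 : N n1 by case/andP: Nn.
rewrite !(inE, mem_cat) => + tp; rewrite (negPf tp) /=.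
case/or4P=> [/eqP eq_t|/eqP eq_t|/orP[]/splitPr eq_s
            |/orP[/eqP eq_t|/splitPr eq_s]].
- subst t; split_walks; left.
  apply: (@rich_cycleI p (e1 ++ n :: e2 ++ a :: u1 ++ n1 :: u2 ++ b ::
    rev s2 ++ y :: rev s12) n n1) => //;
    [walks | use U | use U | | |]; members.
- subst t; split_walks; right.
  exists p, b, s12, s2, e1, n, e2, (rev s11 ++ a :: u1), n1, u2.
  split; last by rewrite size_cat /=; clear; lia.
  by split; [split; walks | walks | walks | use U | walks].
- case: eq_s w1 U {tp} => r1 r2; rewrite walk_cat => w1 U; split_walks; left.
  apply: (@rich_cycleI a (r1 ++ t :: rev e2 ++ n :: rev e1 ++ p :: s12 ++ y ::
    s2 ++ b :: rev u2 ++ n1 :: rev u1) n n1) => //;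
    [walks | use U | use U | | |]; members.
- case: eq_s w1 U {tp} => r1 r2; rewrite !walk_cat => w1 U; split_walks; left.
  apply: (@rich_cycleI a (s11 ++ p :: e1 ++ n :: e2 ++ t :: r2 ++ y ::
    s2 ++ b :: rev u2 ++ n1 :: rev u1) n n1) => //;
    [walks | use U | use U | | |]; members.
- subst t; split_walks; left.
  apply: (@rich_cycleI a (s11 ++ p :: e1 ++ n :: e2 ++ y ::
    s2 ++ b :: rev u2 ++ n1 :: rev u1) n n1) => //;
    [walks | use U | use U | | |]; members.
- case: eq_s w2 U {tp} => s21 s22; rewrite walk_cat => w2 U; split_walks; right.
  exists p, t, s12, s21, e1, n, e2, (rev s11 ++ a :: u1), n1.
  exists (u2 ++ b :: rev s22).
  split; last by rewrite !size_cat /=; clear; lia.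
  by split; [split; walks | walks | walks | use U | walks].
Qed.

End Chords.

Section Closing.
Variables (a b : T) (s1 s2 u1 : seq T) (n1 : T) (u2 v1 : seq T) (n2 : T).
Variable v2 : seq T.
Let th := (a :: b :: s1 ++ y :: s2) ++ (u1 ++ n1 :: u2) ++ v1 ++ n2 :: v2.
Hypothesis th_theta : theta a b s1 s2 u1 n1 u2 v1 n2 v2.

Lemma chord_closes p e t :
    walk p e t -> (forall z, count_mem z (th ++ e) <= 1) ->
    p \in s1 ++ y :: s2 -> t \in (u1 ++ n1 :: u2) ++ v1 ++ n2 :: v2 ->
  rich_cycle \/ shorter_theta (size s1 + size s2).
Proof.
rewrite {}/th => e_walk U; rewrite mem_cat inE => p_s.
rewrite mem_cat => t_uv.
case/or3P: p_s => [p_s1|/eqP eq_p|p_s2].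
- case/orP: t_uv => [t_u|t_v].
    exact: (chord_across th_theta e_walk).
  by apply: (chord_across (theta_swap th_theta) e_walk) => //; use U.
- left; rewrite eq_p in e_walk; case/orP: t_uv => [t_u|t_v].
    exact: (chord_from_y th_theta e_walk).
  by apply: (chord_from_y (theta_swap th_theta) e_walk) => //; use U.
rewrite addnC -(size_rev s1) -(size_rev s2).
case/orP: t_uv => [t_u|t_v].
  apply: (chord_across (theta_rev th_theta) e_walk); first by use U.
    by rewrite mem_rev.
  by move: t_u; rewrite !(mem_cat, inE, mem_rev) => /or3P[]->; rewrite ?orbT.
apply: (chord_across (theta_swap (theta_rev th_theta)) e_walk).
- by use U.
- by rewrite mem_rev.
- by move: t_v; rewrite !(mem_cat, inE, mem_rev) => /or3P[]->; rewrite ?orbT.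
Qed.

Lemma ear_closes p e1 n e2 t :
    walk p e1 n -> walk n e2 t -> N n ->
    (forall z, count_mem z (th ++ e1 ++ n :: e2) <= 1) ->
    p \in s1 ++ y :: s2 -> t \in th -> t != p ->
  rich_cycle \/ shorter_theta (size s1 + size s2).
Proof.
move=> e1_walk e2_walk N_n U p_s; rewrite mem_cat.
(* On the two other paths the ear counts as a chord, with [n] as one of its inner vertices. *)
case/orP=> [t_s tp|t_uv _]; last first.
  by apply: (@chord_closes p (e1 ++ n :: e2) t) => //; rewrite walk_cat e1_walk.
move: U; rewrite {}/th => U.
move: p_s; rewrite mem_cat inE => /or3P[p_s1|/eqP eq_p|p_s2].
- exact: (ear_across th_theta e1_walk e2_walk).
- left; subst p; move: t_s.
  rewrite !(inE, mem_cat) (negPf tp) /=.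
  case/or4P=> [t_a|t_b|t_s1|t_s2].
  + by apply: (ear_from_y th_theta e1_walk e2_walk) => //; rewrite inE t_a.
  + apply: (ear_from_y (theta_rev th_theta) e1_walk e2_walk) => //.
      by use U.
    by rewrite inE t_b.
  + by apply: (ear_from_y th_theta e1_walk e2_walk); rewrite // inE t_s1 orbT.
  + apply: (ear_from_y (theta_rev th_theta) e1_walk e2_walk) => //.
      by use U.
    by rewrite inE mem_rev t_s2 orbT.
rewrite addnC -(size_rev s1) -(size_rev s2).
apply: (ear_across (theta_rev th_theta) e1_walk e2_walk) => //.
- by use U.
- by rewrite mem_rev.
- move: t_s; rewrite !(inE, mem_cat, mem_rev).
  by case/or4P=> [->|->|->|/orP[]->]; rewrite ?orbT.
Qed.

End Closing.

Hypothesis h_V : forall a b, h a b -> V b.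
Hypothesis h_2conn : forall v a b, V a -> V b -> a != v -> b != v ->
  connect (avoiding (pred1 v)) a b.
Hypothesis N_V : forall n, N n -> V n.
Hypothesis yNn : ~~ N y.
Hypothesis y_N_3conn : forall a b, V a -> V b -> a != y -> b != y ->
  exists n, [/\ N n, n != a, n != b & connect (avoiding (pred2 a b)) y n].

Lemma walk_V u s v : walk u s v -> V v.
Proof.
by rewrite /walk -cats1 cat_path /= andbT => /andP[_ /h_V].
Qed.

Lemma theta_rich a b s1 s2 u1 n1 u2 v1 n2 v2 :
  theta a b s1 s2 u1 n1 u2 v1 n2 v2 -> rich_cycle.
Proof.
have [m] := ubnP (size s1 + size s2).
elim: m a b s1 s2 u1 n1 u2 v1 n2 v2 => // m IHm a b s1 s2 u1 n1 u2 v1 n2 v2.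
rewrite ltnS => size_s th_theta.
suff [//|[a' [b' [s1' [s2' [u1' [n1' [u2' [v1' [n2' [v2' [th' lt_s]]]]]]]]]]]] :
    rich_cycle \/ shorter_theta (size s1 + size s2).
  exact: IHm (leq_trans lt_s size_s) th'.
case: (th_theta) => [[w1 w2] w3 w4 U Nn].
have [Nn1 Nn2] := andP Nn.
(* A vertex of [N] in [s1] or [s2] is enough: the paths through [y] and [n1] then form the cycle. *)
have [n_s1|/hasPn s1Nn] := boolP (has N s1).
  case/hasP: n_s1 => n /splitPr eq_s Nn'; left.
  case: eq_s w1 U {th_theta size_s} => s11 s12; rewrite walk_cat => w1 U.
  split_walks.
  apply: (@rich_cycleI a (s11 ++ n :: s12 ++ y :: s2 ++ b :: rev u2 ++ n1 ::
    rev u1) n n1) => //; [walks | use U | use U | | |]; members.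
have [n_s2|/hasPn s2Nn] := boolP (has N s2).
  case/hasP: n_s2 => n /splitPr eq_s Nn'; left.
  case: eq_s w2 U {th_theta size_s} => s21 s22; rewrite walk_cat => w2 U.
  split_walks.
  apply: (@rich_cycleI a (s1 ++ y :: s21 ++ n :: s22 ++ b :: rev u2 ++ n1 ::
    rev u1) n n1) => //; [walks | use U | use U | | |]; members.
have [ay by_] : a != y /\ b != y.
  split; apply/negP => /eqP eq_y; move: (U y); rewrite eq_y;
  rewrite !(count_cat, count_cons) /= eqxx; clear; lia.
have Va : V a by apply: (@walk_V y (rev s1)); rewrite walk_rev.
have Vb : V b by apply: walk_V w2.
have [n [N_n na nb]] := y_N_3conn Va Vb ay by_.
(* Avoiding [a] and [b], some walk leaves the interior of the path through [y]; [q] is its first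
   vertex that lies on another path or is a new vertex of [N], so everything between [p] and [q] is
   off the theta. *)
case/(@connect_walk _ (mem (s1 ++ y :: s2))
  [pred z | (z \notin a :: b :: s1 ++ y :: s2) &&
            ((z \in (u1 ++ n1 :: u2) ++ v1 ++ n2 :: v2) || N z)]).
- by move=> z /= z_s; rewrite 2!in_cons z_s !orbT.
- by rewrite /= mem_cat inE eqxx orbT.
- rewrite /= N_n orbT andbT !(inE, mem_cat) !negb_or na nb /=.
  apply/and3P; split.
  + by apply/negP => /s1Nn; rewrite N_n.
  + by apply: contraNneq yNn => <-.
  + by apply/negP => /s2Nn; rewrite N_n.
move=> p [q [e [/= p_s /andP[q_out q_in] e_walk Ue ave]]].
have Uth := introT (uniq_count _) U.
set th := (a :: b :: s1 ++ y :: s2) ++ (u1 ++ n1 :: u2) ++ v1 ++ n2 :: v2.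
have e_th z : z \in e -> z \notin th.
  move=> /ave[z_s /= z_Y z_ab].
  have z_out : z \notin a :: b :: s1 ++ y :: s2.
    by rewrite 2!in_cons !negb_or z_s andbT -negb_or.
  rewrite /th mem_cat negb_or z_out.
  by move: z_Y; rewrite z_out /= negb_or => /andP[].
have [q_uv|q_uv] := boolP (q \in (u1 ++ n1 :: u2) ++ v1 ++ n2 :: v2).
  apply: (chord_closes th_theta e_walk _ p_s q_uv).
  apply/uniq_count; rewrite -/th uniq_catC; exact: cat_uniq_disjoint.
have N_q : N q by move: q_in; rewrite (negPf q_uv).
have q_th : q \notin th by rewrite /th mem_cat negb_or q_out.
have p_th : p \in th by rewrite /th mem_cat 2!in_cons p_s !orbT.
have a_th : a \in th by rewrite inE eqxx.
have ap : a != p.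
  apply: contraTneq p_s => <-; move: Uth.
  by rewrite cons_uniq in_cons mem_cat !negb_or => /andP[/and3P[]].
(* Here [q] is a vertex of [N] off the theta, and the walk to it is completed to an ear; [a] is a
   vertex other than [p] for the ear to aim at. *)
have [t [e1 [e2 [t_th tp e1_walk e2_walk [Ue12 av12]]]]] :=
  ear_through h_V h_2conn p_th a_th ap Va e_walk e_th q_th.
apply: (ear_closes th_theta e1_walk e2_walk) => //.
by apply/uniq_count; rewrite -/th uniq_catC; exact: cat_uniq_disjoint.
Qed.

(** * Ears attached to a cycle through [y] and [n1] *)

Definition cycle_through c1 n1 c2 : Prop :=
  [/\ walk y c1 n1, walk n1 c2 y,
      forall z, count_mem z (y :: c1 ++ n1 :: c2) <= 1 & N n1].

Lemma cycle_through_rev c1 n1 c2 :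
  cycle_through c1 n1 c2 -> cycle_through (rev c2) n1 (rev c1).
Proof. by case=> w1 w2 U Nn1; split; [walks | walks | use U |]. Qed.

Section CycleEar.
Variables (c1 : seq T) (n1 : T) (c2 : seq T) (p : T) (e1 : seq T) (n : T).
Variables (e2 : seq T) (t : T).
Hypotheses (cyc : cycle_through c1 n1 c2) (N_n : N n).
Hypotheses (e1_walk : walk p e1 n) (e2_walk : walk n e2 t).
Hypothesis U : forall z,
  count_mem z ((y :: c1 ++ n1 :: c2) ++ e1 ++ n :: e2) <= 1.

Lemma cycle_ear_from_y : p = y -> t \in rcons c1 n1 -> rich_cycle.
Proof.
case: cyc => w1 w2 _ Nn1 eq_p; have := e1_walk; rewrite eq_p => e1_walk'.
rewrite mem_rcons inE => /predU1P[eq_t|/splitPr eq_c].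
  have := e2_walk; rewrite eq_t => e2_walk'.
  apply: (@rich_cycleI y (e1 ++ n :: e2 ++ n1 :: c2) n n1) => //;
    [walks | use U | use U | | |]; members.
case: eq_c w1 (U) => c11 c12; rewrite walk_cat => w1 U'; split_walks.
apply: (@rich_cycleI y (e1 ++ n :: e2 ++ t :: c12 ++ n1 :: c2) n n1) => //;
  [walks | use U' | use U' | | |]; members.
Qed.

(** Only when [p] and [t] separate [y] from [n1] on the cycle does a theta arise, with branch
    vertices [p] and [t]; otherwise the ear replaces an arc with neither [y] nor [n1] inside. *)
Lemma cycle_ear_across : p \in c1 -> t \in y :: c1 ++ n1 :: c2 -> t != p ->
  rich_cycle.
Proof.
case: cyc => w1 w2 _ Nn1 /splitPr eq_c.
case: eq_c w1 (U) => c11 c12; rewrite walk_cat => w1 U'.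
rewrite !(inE, mem_cat) => + tp; rewrite (negPf tp) /=.
case/or3P=> [/eqP eq_t|/orP[]/splitPr eq_s|/orP[/eqP eq_t|/splitPr eq_s]].
- have := e2_walk; rewrite eq_t => e2_walk'; split_walks.
  apply: (@rich_cycleI y (rev e2 ++ n :: rev e1 ++ p :: c12 ++ n1 :: c2)
    n n1) => //; [walks | use U' | use U' | | |]; members.
- case: eq_s w1 U' {tp} => r1 r2; rewrite walk_cat => w1 {}U'; split_walks.
  apply: (@rich_cycleI y (r1 ++ t :: rev e2 ++ n :: rev e1 ++ p :: c12 ++
    n1 :: c2) n n1) => //; [walks | use U' | use U' | | |]; members.
- case: eq_s w1 U' {tp} => r1 r2; rewrite !walk_cat => w1 {}U'; split_walks.
  apply: (@rich_cycleI y (c11 ++ p :: e1 ++ n :: e2 ++ t :: r2 ++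
    n1 :: c2) n n1) => //; [walks | use U' | use U' | | |]; members.
- have := e2_walk; rewrite eq_t => e2_walk'; split_walks.
  apply: (@rich_cycleI y (c11 ++ p :: e1 ++ n :: e2 ++ n1 :: c2) n n1) => //;
    [walks | use U' | use U' | | |]; members.
- case: eq_s w2 U' {tp} => r1 r2; rewrite walk_cat => w2 {}U'; split_walks.
  apply: (@theta_rich p t (rev c11) (rev r2) c12 n1 r1 e1 n e2).
  by split; [split; walks | walks | walks | use U' | walks].
Qed.

End CycleEar.

(** Reversing the cycle exchanges [c1] and [c2]; reversing the ear exchanges its ends and settles
    [p = n1]. *)
Lemma cycle_ear_rich c1 n1 c2 p e1 n e2 t :
    cycle_through c1 n1 c2 -> N n -> walk p e1 n -> walk n e2 t ->
    (forall z, count_mem z ((y :: c1 ++ n1 :: c2) ++ e1 ++ n :: e2) <= 1) ->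
    p \in y :: c1 ++ n1 :: c2 -> t \in y :: c1 ++ n1 :: c2 -> t != p ->
  rich_cycle.
Proof.
move=> cyc N_n e1_walk e2_walk U p_c t_c tp.
have cyc' := cycle_through_rev cyc.
have e1_walk' : walk n (rev e1) p by rewrite walk_rev.
have e2_walk' : walk t (rev e2) n by rewrite walk_rev.
have rev_c z : z \in y :: c1 ++ n1 :: c2 -> z \in y :: rev c2 ++ n1 :: rev c1.
  rewrite !(inE, mem_cat, mem_rev).
  by case/or4P=> ->; rewrite ?orbT.
have pt : p != t by rewrite eq_sym.
have interior : forall q, q \in y :: c1 ++ n1 :: c2 ->
    [\/ q = y, q = n1, q \in c1 | q \in rev c2].
  move=> q; rewrite !(inE, mem_cat, mem_rev).
  case/or4P=> [/eqP|||]; [constructor 1 | constructor 3 | | constructor 4] => //.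
  by move/eqP; constructor 2.
have [p_y|p_n1|p_c1|p_c2] := interior p p_c.
- have [t_y|t_n1|t_c1|t_c2] := interior t t_c.
  + by rewrite t_y p_y eqxx in tp.
  + apply: (cycle_ear_from_y cyc N_n e1_walk e2_walk U) => //.
    by rewrite mem_rcons inE t_n1 eqxx.
  + apply: (cycle_ear_from_y cyc N_n e1_walk e2_walk U) => //.
    by rewrite mem_rcons inE t_c1 orbT.
  + apply: (cycle_ear_from_y cyc' N_n e1_walk e2_walk) => //; first by use U.
    by rewrite mem_rcons inE t_c2 orbT.
- have [t_y|t_n1|t_c1|t_c2] := interior t t_c.
  + apply: (cycle_ear_from_y cyc N_n e2_walk' e1_walk') => //; first by use U.
    by rewrite mem_rcons inE p_n1 eqxx.
  + by rewrite t_n1 p_n1 eqxx in tp.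
  + by apply: (cycle_ear_across cyc N_n e2_walk' e1_walk') => //; use U.
  + by apply: (cycle_ear_across cyc' N_n e2_walk' e1_walk') => //;
      [use U | apply: rev_c].
- exact: (cycle_ear_across cyc N_n e1_walk e2_walk U).
- by apply: (cycle_ear_across cyc' N_n e1_walk e2_walk) => //;
    [use U | apply: rev_c].
Qed.

(** A path from [o1] to [w] leaves [th] for the last time at some [p]; of the two given vertices,
    one differs from [p] and can be the target of the ear. *)
Lemma ear_exists (th : seq T) o1 o2 w :
    o1 \in th -> o2 \in th -> o1 != o2 -> V o1 -> V o2 -> V w -> w \notin th ->
  exists2 p, p \in th & ear th p w.
Proof.
move=> o1_th o2_th o12 Vo1 Vo2 Vw w_th.
have w2 : w != o2 by apply: contraNneq w_th => ->.
case/(@connect_walk _ (mem th) (pred1 w)): (h_2conn Vo1 Vw o12 w2).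
- by move=> z /= z_th; apply: contraNneq w_th => <-.
- by [].
- exact: eqxx.
move=> p [_ [s [/= p_th /eqP-> s_walk _ av]]]; exists p => //.
have av' z : z \in s -> z \notin th by case/av.
have [eq_p|o1p] := eqVneq o1 p.
  apply: (ear_through h_V h_2conn p_th o2_th _ Vo2 s_walk) => //.
  by rewrite -eq_p eq_sym.
exact: (ear_through h_V h_2conn p_th o1_th o1p Vo1 s_walk).
Qed.

Lemma rich_cycle_exists o : V y -> V o -> o != y -> rich_cycle.
Proof.
move=> Vy Vo oy.
(* With both removed vertices equal, the hypothesis gives a vertex of [N] other than that vertex.
   Here the path from [y] to it provides a neighbour [y'] of [y]. *)
have [n [N_n _ _]] := y_N_3conn Vo Vo oy oy.
case/connectP=> l0 l0_path; case/shortenP: l0_path => l l_path Ul _ n_last.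
case: l l_path Ul n_last => [_ _ /= n_y|y' l /= l_path Ul _].
  by move: yNn; rewrite -n_y N_n.
have hyy' : h y y' by case/andP: l_path => /and3P[].
have Vy' := h_V hyy'.
have y'_y : y' != y by case/andP: Ul; rewrite inE negb_or eq_sym => /andP[].
have [n1 [N_n1 n1y' _ _]] := y_N_3conn Vy' Vy' y'_y y'_y.
have n1y : n1 != y by apply: contraTneq N_n1 => ->.
(* An ear through [n1] attached to the two ends of the edge [yy'] closes up with that edge. *)
have [c1 [c2 cyc]] : exists c1 c2, cycle_through c1 n1 c2.
  have yy' : y != y' by rewrite eq_sym.
  have [|||p p_th [t [e1 [e2 [t_th tp e1_walk e2_walk [Ue av]]]]]] :=
    @ear_exists [:: y; y'] y y' n1 _ _ yy' Vy Vy' (N_V N_n1);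
    rewrite ?inE ?eqxx ?orbT ?negb_or ?n1y //.
  have /uniq_count U : uniq ((e1 ++ n1 :: e2) ++ [:: y; y']).
    by apply: cat_uniq_disjoint => //=; rewrite inE yy'.
  rewrite !inE in p_th t_th.
  case/orP: p_th tp e1_walk => /eqP->; case/orP: t_th e2_walk => /eqP->;
    rewrite ?eqxx // => e2_walk _ e1_walk.
    exists e1, (e2 ++ [:: y']); split=> //; last by use U.
    by rewrite walk_cat e2_walk walk_nil h_sym.
  exists (rev e2), (rev e1 ++ [:: y']); split=> //; last by use U.
    by rewrite walk_rev.
  by rewrite walk_cat walk_rev e1_walk walk_nil h_sym.
have [n2 [N_n2 n21 _ _]] := y_N_3conn (N_V N_n1) (N_V N_n1) n1y n1y.
have [w1 w2 U _] := cyc.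
have n2y : n2 != y by apply: contraTneq N_n2 => ->.
have [n2_c|n2_c] := boolP (n2 \in y :: c1 ++ n1 :: c2).
  exists (c1 ++ n1 :: c2), n1, n2; rewrite walk_cat w1 w2; split=> //.
  - exact/uniq_count.
  - split; first by rewrite mem_cat inE eqxx orbT.
    by move: n2_c; rewrite inE (negPf n2y).
  - by rewrite eq_sym.
have [|||p p_c [t [e1 [e2 [t_c tp e1_walk e2_walk [Ue av]]]]]] :=
  @ear_exists (y :: c1 ++ n1 :: c2) y n1 n2 _ _ _ Vy (N_V N_n1) (N_V N_n2) n2_c.
- exact: mem_head.
- by rewrite inE mem_cat inE eqxx !orbT.
- by rewrite eq_sym.
apply: (cycle_ear_rich cyc N_n2 e1_walk e2_walk) => //.
apply/uniq_count; rewrite uniq_catC; apply: cat_uniq_disjoint => //.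
exact/uniq_count.
Qed.

End RichCycle.
End Walks.

Lemma connected_withoutP (G : sgraph) (S : {set G}) a b :
  connected_without S -> a \notin S -> b \notin S ->
  connect (avoiding (@adj G) (mem S)) a b.
Proof.
move=> /forall_inP connS aS bS.
have /forall_inP := connS a (etrans (in_setC _ _) aS).
by move/(_ b (etrans (in_setC _ _) bS)).
Qed.

Lemma kconnected_without (G : sgraph) k (S : {set G}) :
  kconnected G k -> #|S| < k -> connected_without S.
Proof. by case/andP=> _ /forallP/(_ S)/implyP. Qed.

(** * An edge whose deletion preserves 3-connectivity *)

Section DeletedEdge.
Variables (G : sgraph) (x y : G).
Hypotheses (adj_xy : adj x y) (G'_3conn : kconnected (delete_edge x y) 3).

Let G' := delete_edge x y.
Let N : pred G := [pred n | (n != y) && adj x n].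
Let V : pred G := predC1 x.
Let h : rel G := [rel a b | [&& a != x, b != x & adj a b]].

Let xy : x != y.
Proof. by apply: contraTneq adj_xy => ->; rewrite adj_irrefl. Qed.

Let del_adj_yx : @del_adj G x y y x = false.
Proof. by rewrite /del_adj /= setUC eqxx andbF. Qed.

Let G'_connect (S : {set G}) a b : #|S| < 3 -> a \notin S -> b \notin S ->
  connect (avoiding (@del_adj G x y) (mem S)) a b.
Proof.
move=> card_S; apply: (@connected_withoutP G').
exact: kconnected_without G'_3conn card_S.
Qed.

(** Otherwise [N], the neighbourhood of [x] in [G'], would be a set of at most two vertices
    separating [x] from [y]. *)
Lemma card_neighbours_del : 2 < #|[set n | N n]|.
Proof.
rewrite ltnNge -ltnS; apply/negP => card_N.
have : connect (avoiding (@del_adj G x y) (mem [set n | N n])) x y.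
  by apply: G'_connect; rewrite // inE /N /= ?eqxx ?adj_irrefl ?andbF.
case/connectP=> [[_ eq_yx|z l /= /andP[/and3P[_ Nz adj_xz] _] _]].
  by move: xy; rewrite eq_yx eqxx.
case/andP: adj_xz => adj_xz; case: eqP => // /eqP xz_xy _.
move: Nz; rewrite /= inE /N /= adj_xz andbT negbK => /eqP eq_z.
by move: xz_xy; rewrite eq_z eqxx.
Qed.

Lemma deg_gt3 : 3 < deg x.
Proof.
apply: (leq_ltn_trans card_neighbours_del); apply: proper_card.
apply/properP; split; first by apply/subsetP => n; rewrite !inE => /andP[].
by exists y; rewrite inE /N /= ?eqxx.
Qed.

Lemma nonessential_center : x \in wheel_centers G.
Proof.
have h_V a b : h a b -> V b by case/and3P.
have h_sym : symmetric h.
  by move=> a b; rewrite /h /= adj_sym; case: (a != x); case: (b != x).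
have h_2conn v a b : V a -> V b -> a != v -> b != v ->
    connect (avoiding h (pred1 v)) a b.
  rewrite /V /= => ax bx av bv.
  (* Deleting [v] from H amounts to deleting [x] and [v] from [G']. *)
  have : connect (avoiding (@del_adj G x y) (mem [set x; v])) a b.
    apply: G'_connect; rewrite ?inE ?negb_or ?ax ?bx ?av ?bv //.
    by rewrite cards2; case: (_ != _).
  apply: connect_sub => c d; rewrite /avoiding /= !inE !negb_or.
  case/and3P=> /andP[cx cv] /andP[dx dv] /andP[cd _].
  by apply: connect1; rewrite /avoiding /h /= cx cv dx dv.
have N_V n : N n -> V n.
  by case/andP=> _; apply: contraTneq => ->; rewrite adj_irrefl.
have y_N a b : V a -> V b -> a != y -> b != y -> exists n,
    [/\ N n, n != a, n != b & connect (avoiding h (pred2 a b)) y n].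
  rewrite /V /= => ax bx ay by_.
  (* A path of [G'] from [y] to [x], cut just before [x], stays in H and ends in [N]: its last
     vertex is not [y], as the edge [xy] is absent. *)
  have : connect (avoiding (@del_adj G x y) (mem [set a; b])) y x.
    apply: G'_connect; rewrite ?inE ?negb_or 1?eq_sym ?ay 1?eq_sym ?by_ //.
    - by rewrite cards2; case: (_ != _).
    - by rewrite [x == a]eq_sym ax [x == b]eq_sym.
  case/connectP=> l0; case/shortenP=> l + Ul _.
  case/lastP: l Ul => [_ _ /= eq_x|s x' Ul].
    by move: xy; rewrite eq_x eqxx.
  rewrite last_rcons rcons_path => /andP[s_path s_last] eq_x'; subst x'.
  have xs : x \notin y :: s.
    by move: Ul; rewrite -rcons_cons rcons_uniq => /andP[].
  exists (last y s); move: s_last => /= /and3P[+ _ adj_last].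
  rewrite !inE negb_or => /andP[-> ->]; split=> //.
    apply/andP; split; last by rewrite adj_sym; case/andP: adj_last.
    by apply: contraTneq adj_last => ->; rewrite -/(del_adj x y y x) del_adj_yx.
  apply/connectP; exists s => //.
  apply: (sub_in_path (P := predC1 x) _ _ s_path).
    move=> c d; rewrite /avoiding /h !inE /= !inE !negb_or => cx dx.
    by case/and3P=> /andP[-> ->] /andP[-> ->] /andP[-> _]; rewrite cx dx.
  by apply/allP => z z_s; rewrite inE; apply: contraNneq xs => <-.
have yNn : ~~ N y by rewrite /N /= eqxx.
have [o N_o] : exists o, N o.
  have /card_gt0P[o] := ltn_trans (isT : 0 < 2) card_neighbours_del.
  by rewrite inE => N_o; exists o.
have oy : o != y by case/andP: N_o.
have Vy : V y by rewrite /V /= eq_sym.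
have [s [n [n' [s_walk Us [ns n's] [Nn Nn'] nn']]]] :=
  rich_cycle_exists h_sym h_V h_2conn N_V yNn y_N Vy (N_V _ N_o) oy.
apply/wheel_centersP; exists (y :: s).
have ny : n != y by case/andP: Nn.
have n'y : n' != y by case/andP: Nn'.
have sub_s : [:: y; n; n'] \subset y :: s.
  apply/subsetP => z; rewrite !inE.
  by case/or3P=> /eqP->; rewrite ?eqxx ?ns ?n's ?orbT.
have U3 : uniq [:: y; n; n'] by rewrite /= !inE negb_or !(eq_sym y) ny n'y nn'.
apply/and3P; split.
- apply/andP; split.
    by apply: (uniq_leq_size U3) => z; apply: (subsetP sub_s).
  by rewrite /ucycleb Us andbT; apply: sub_path s_walk => a b /and3P[].
- apply/negP => x_s; have x_in : x \in rcons s y by rewrite mem_rcons.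
  move: s_walk; rewrite /walk; case/splitPr: x_in => l1 l2.
  by rewrite cat_path /= /h /= eqxx !andbF.
have <- : #|[:: y; n; n']| = 3 by apply/card_uniqP.
apply: subset_leq_card; apply/subsetP => z z3.
rewrite inE (subsetP sub_s) //= inE; move: z3; rewrite !inE.
by case/or3P=> /eqP-> //; [case/andP: Nn | case/andP: Nn'].
Qed.

(** In an almost wheel-free graph every wheel center has degree 3, whereas [x] is a center of larger
    degree. *)
Lemma nonessential_not_almost_wheel_free : ~ almost_wheel_free G.
Proof.
have x_W := nonessential_center; have := deg_gt3.
move=> deg_x [eqW|[u eqW deg_u]|[u [v [eqW _ deg_u deg_v]]]].
- by rewrite eqW inE in x_W.
- by move: x_W deg_x; rewrite eqW inE => /eqP->; rewrite deg_u.
- by move: x_W deg_x; rewrite eqW !inE => /orP[] /eqP->; rewrite ?deg_u ?deg_v.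
Qed.

End DeletedEdge.

(** * Loss of connectivity under deletion of an edge *)

Lemma kconnected_delete_edge (G : sgraph) (x y : G) k :
  x != y -> kconnected G k.+1 -> kconnected (delete_edge x y) k.
Proof.
move=> xy conn; case/andP: (conn) => card_G _.
apply/andP; split; first exact: ltnW.
apply/forallP => S; apply/implyP => card_S.
(* Removing an end [w] of the edge together with [S] removes the edge as well, so paths avoiding
   [w |: S], a set of at most [k] vertices, survive in [delete_edge x y]. *)
have without (w : G) : forall a b : G, a != w -> b != w ->
    w = x \/ w = y -> a \notin S -> b \notin S ->
  connect (avoiding (@del_adj G x y) (mem S)) a b.
  move=> a b aw bw w_xy aS bS.
  have : connect (avoiding (@adj G) (mem (w |: S))) a b.
    apply: connected_withoutP; rewrite ?inE ?negb_or ?aw ?bw //.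
    apply: kconnected_without conn _.
    by rewrite cardsU1; case: (w \notin S); rewrite //= ltnS // ltnW.
  apply: connect_sub => c d; rewrite /avoiding /= !inE !negb_or.
  case/and3P=> /andP[cw cS] /andP[dw dS] cd.
  apply: connect1; rewrite /avoiding /del_adj /= cS dS cd /=.
  apply/negP => /eqP/setP/(_ w); rewrite !inE ![w == _]eq_sym.
  rewrite (negPf cw) (negPf dw).
  by case: w_xy => ->; rewrite eqxx ?orbT.
(* A vertex [z] off the edge and outside [S] is a hub: each remaining vertex is joined to it by a
   path avoiding [x] or one avoiding [y]. It exists because [#|S| + 2 <= k.+1 < #|G|]. *)
have [z z_out] : exists z, z \notin [set x; y] :|: S.
  apply/existsP; rewrite -negb_forall; apply/negP => /forallP all_in.
  have : #|G| <= #|[set x; y] :|: S|.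
    by apply: subset_leq_card; apply/subsetP => z _; apply: all_in.
  apply/negP; rewrite -ltnNge.
  apply: leq_ltn_trans (leq_card_setU _ _) _; rewrite cards2 xy.
  by apply: leq_ltn_trans card_G; rewrite add2n ltnS; apply: card_S.
move: z_out; rewrite !inE !negb_or => /andP[/andP[zx zy] zS].
have to_z a : a \notin S ->
    connect (avoiding (@del_adj G x y) (mem S)) a z /\
    connect (avoiding (@del_adj G x y) (mem S)) z a.
  move=> aS; have [eq_a|ax] := eqVneq a x.
    by split; apply: (without y) => //; rewrite ?eq_a //; right.
  by split; apply: (without x) => //; left.
apply/forall_inP => a; rewrite inE => aS.
apply/forall_inP => b; rewrite inE => bS.
change (connect (avoiding (@del_adj G x y) (mem S)) a b).
by apply: (connect_trans (proj1 (to_z a aS)) (proj2 (to_z b bS))).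
Qed.

Theorem corollary4p6 (G : sgraph) :
  kconnected G 3 -> almost_wheel_free G -> minimally_kconnected G 3.
Proof.
move=> conn3 awf; have card_G : 3 < #|G| by case/andP: conn3.
have G_gt0 : 0 < #|G| by apply: leq_trans card_G.
have kappa_ge3 : 3 <= kappa G by rewrite leq_kappa.
have no_edge (x y : G) : adj x y -> ~~ kconnected (delete_edge x y) 3.
  move=> adj_xy; apply/negP => conn.
  exact: (nonessential_not_almost_wheel_free adj_xy conn awf).
have kappa3 : kappa G = 3.
  apply/eqP; rewrite eqn_leq kappa_ge3 andbT leqNgt leq_kappa //.
  (* A 4-connected graph would stay 3-connected after the deletion of any edge, and an edge exists
     by connectedness. *)
  apply/negP => conn4.
  have [x [y adj_xy]] : exists x y : G, adj x y.
    have /card_gt1P[x [y [_ _ xy]]] : 1 < #|G| by apply: ltn_trans card_G.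
    have : connect (avoiding (@adj G) (mem (set0 : {set G}))) x y.
      apply: connected_withoutP; rewrite ?inE //.
      by apply: kconnected_without conn3 _; rewrite cards0.
    case/connectP=> [[_ eq_y|z l /= /andP[/and3P[_ _ xz] _] _]].
      by rewrite eq_y eqxx in xy.
    by exists x, z.
  have xy : x != y by apply: contraTneq adj_xy => ->; rewrite adj_irrefl.
  by have /negP := no_edge x y adj_xy; apply; apply: kconnected_delete_edge.
split=> // x y adj_xy; rewrite /essential kappa3 ltnNge.
by rewrite leq_kappa //; apply: no_edge.
Qed.
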